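(* The ordered moduli space $\mathcal{M}^{\mathrm{ord}}(\mathcal{C})$ has exactly two elements. Moreover, representatives of them can be chosen to have the following equations: $$M_1: z=0,\quad M_2: x=0,\quad M_3: x=z,\quad M_4: x=-(\gamma+1)z,\quad M_5: x=(\gamma+2)z,$$ $$L_1: y=x,\quad L_2: y=\gamma(x-z),\quad L_3: y=\gamma x+z,\quad L_4: y=z,\quad L_5: y=0,$$ where $\gamma^2+\gamma-1=0$ (one representative for each of the two roots $\gamma$).
   Context: A line combinatorics is a triple $(\mathcal{L},\mathcal{P},\in)$ where $\mathcal{L}$ (lines) and $\mathcal{P}$ (points) are finite sets and $\in$ is a relation between $\mathcal{P}$ and $\mathcal{L}$ such that any two distinct $\ell,\ell'\in\mathcal{L}$ have exactly one $p\in\mathcal{P}$ with $p\in\ell$ and $p\in\ell'$ (written $p=\ell\cap\ell'$), and every $p\in\mathcal{P}$ is of the form $\ell\cap\ell'$ for some $\ell\neq\ell'$. It is ordered if $\mathcal{L}$ is ordered. Let $\mathcal{C}$ be the ordered line combinatorics with ten lines $M_1,\dots,M_5,L_1,\dots,L_5$ whose points (each described by the full set of lines through it) are: one point $\{M_1,M_2,M_3,M_4,M_5\}$; ten points on exactly three lines $$\{M_1,L_2,L_3\},\ \{M_1,L_4,L_5\},\ \{M_2,L_1,L_5\},\ \{M_2,L_3,L_4\},\ \{M_3,L_1,L_4\},$$ $$\{M_3,L_2,L_5\},\ \{M_4,L_1,L_2\},\ \{M_4,L_3,L_5\},\ \{M_5,L_1,L_3\},\ \{M_5,L_2,L_4\};$$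 and five double points $\{M_i,L_i\}$, $i=1,\dots,5$. An ordered complex realization of $\mathcal{C}$ is an ordered tuple of ten distinct lines in $\mathbb{P}^2=\mathbb{C}\mathbb{P}^2$ (coordinates $[x:y:z]$), indexed by the lines of $\mathcal{C}$, whose ordered combinatorics (lines, multiple points, incidence) agrees with $\mathcal{C}$; equivalently, a subset of at least two of the lines is concurrent in $\mathbb{P}^2$ if and only if the corresponding lines of $\mathcal{C}$ share a common point of $\mathcal{C}$. The set of these is $\Sigma^{\mathrm{ord}}(\mathcal{C})$, and the ordered moduli space is $\mathcal{M}^{\mathrm{ord}}(\mathcal{C}):=\Sigma^{\mathrm{ord}}(\mathcal{C})/\mathrm{PGL}(3;\mathbb{C})$. *)

(* Defs.v *)
From HB Require Import structures.
From mathcomp Require Import all_boot all_order all_algebra.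
From mathcomp Require Import complex.
From mathcomp Require Import boolp classical_sets functions cardinality reals.

Set Implicit Arguments.
Unset Strict Implicit.
Unset Printing Implicit Defensive.

Import Order.TTheory GRing.Theory Num.Theory.
Local Open Scope classical_set_scope.
Local Open Scope ring_scope.

(* A finite totally ordered set of n lines is identified with 'I_n, so that
   ordered combinatorics carry no isomorphism other than relabelling of the
   points. [inc p l] reads "p lies on l". *)
Record ordered_line_combinatorics (n : nat) := OrderedLineCombinatorics {
  points : finType;
  inc : points -> 'I_n -> bool;
  inc_meet : forall l l' : 'I_n, l != l' ->
    exists! p : points, inc p l /\ inc p l';
  inc_point : forall p : points, exists l l' : 'I_n,
    [/\ l != l', inc p l & inc p l'] }.

Section CombinatoricsC.

Let M1 : 'I_10 := Ordinal (isT : 0 < 10)%N.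
Let M2 : 'I_10 := Ordinal (isT : 1 < 10)%N.
Let M3 : 'I_10 := Ordinal (isT : 2 < 10)%N.
Let M4 : 'I_10 := Ordinal (isT : 3 < 10)%N.
Let M5 : 'I_10 := Ordinal (isT : 4 < 10)%N.
Let L1 : 'I_10 := Ordinal (isT : 5 < 10)%N.
Let L2 : 'I_10 := Ordinal (isT : 6 < 10)%N.
Let L3 : 'I_10 := Ordinal (isT : 7 < 10)%N.
Let L4 : 'I_10 := Ordinal (isT : 8 < 10)%N.
Let L5 : 'I_10 := Ordinal (isT : 9 < 10)%N.

(* The lines are ordered M_1, ..., M_5, L_1, ..., L_5; a point is given by the
   list of all the lines through it. *)
Definition pointsC : 16.-tuple (seq 'I_10) :=
  [tuple [:: M1; M2; M3; M4; M5];
         [:: M1; L2; L3]; [:: M1; L4; L5];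
         [:: M2; L1; L5]; [:: M2; L3; L4];
         [:: M3; L1; L4]; [:: M3; L2; L5];
         [:: M4; L1; L2]; [:: M4; L3; L5];
         [:: M5; L1; L3]; [:: M5; L2; L4];
         [:: M1; L1]; [:: M2; L2]; [:: M3; L3]; [:: M4; L4]; [:: M5; L5]].

End CombinatoricsC.

Definition incC (p : 'I_16) (l : 'I_10) : bool := l \in tnth pointsC p.

Lemma incC_meet (l l' : 'I_10) : l != l' ->
  exists! p : 'I_16, incC p l /\ incC p l'.
Proof.
move=> ll'.
pose f (l l' : 'I_10) :=
  find (fun s : seq 'I_10 => (l \in s) && (l' \in s)) pointsC.
have fP (k k' : 'I_10) : (k != k') ==>
    (f k k' < 16)%N && all (fun i =>
      ((k \in nth [::] pointsC i) && (k' \in nth [::] pointsC i))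
        == (i == f k k')) (iota 0 16).
  case: k => [[|[|[|[|[|[|[|[|[|[|//]]]]]]]]]] ?];
  by case: k' => [[|[|[|[|[|[|[|[|[|[|//]]]]]]]]]] ?]; vm_compute.
have := fP l l'; rewrite ll' implyTb => /andP[fl /allP fE].
have E (p : 'I_16) : incC p l && incC p l' = (p == f l l' :> nat).
  apply/eqP; rewrite /incC !(tnth_nth [::]).
  by apply: fE; rewrite mem_iota /= ltn_ord.
exists (Ordinal fl); split.
  by apply/andP; rewrite E.
by move=> p /andP; rewrite E => /eqP pE; apply: val_inj.
Qed.

Lemma incC_point (p : 'I_16) : exists l l' : 'I_10,
  [/\ l != l', incC p l & incC p l'].
Proof.
exists (nth ord0 (tnth pointsC p) 0), (nth ord0 (tnth pointsC p) 1).
have [h u] : (1 < size (tnth pointsC p))%N /\ uniq (tnth pointsC p).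
  rewrite (tnth_nth [::]).
  by case: p => [[|[|[|[|[|[|[|[|[|[|[|[|[|[|[|[|//]]]]]]]]]]]]]]]] ?]; vm_compute.
split; last 2 first.
- by apply: mem_nth; apply: ltnW.
- exact: mem_nth.
by rewrite nth_uniq // ltnW.
Qed.

Definition combinatoricsC : ordered_line_combinatorics 10 :=
  OrderedLineCombinatorics incC_meet incC_point.

Section ProjectivePlane.
Variable R : realType.
Local Notation C := R[i].

Definition P2 := {V : {vspace 'rV[C]_3} | \dim V == 1%N}.

(* The points [x : y : z] all of whose homogeneous coordinates satisfy E; it is
   only used with homogeneous linear equations E. *)
Definition locus (E : C -> C -> C -> Prop) : set P2 :=
  [set p : P2 | forall v : 'rV[C]_3, v \in val p -> E (v 0 0) (v 0 1) (v 0 2)].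

Definition is_line (l : set P2) : Prop :=
  exists a b c : C, (a, b, c) != (0, 0, 0) /\
    l = locus (fun x y z => a * x + b * y + c * z = 0).

(* PGL(3; C), as the group of the transformations of the projective plane that
   are induced by invertible matrices. *)
Definition PGL3 : set (P2 -> P2) :=
  [set g | exists2 A : 'M[C]_3, A \in unitmx &
    forall p : P2, val (g p) = (linfun (mulmxr A) @: val p)%VS].

Section Realizations.
Variables (n : nat) (K : ordered_line_combinatorics n).

Definition multiple_points (A : 'I_n -> set P2) : set P2 :=
  [set p | exists l l' : 'I_n, [/\ l != l', A l p & A l' p]].

Definition ordered_realizations : set ('I_n -> set P2) :=
  [set A | [/\ forall l, is_line (A l), injective A &
    exists2 f : points K -> P2,
      set_bij [set: points K] (multiple_points A) f &
      forall p l, A l (f p) <-> inc p l]].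

Definition PGL3_orbit (A : 'I_n -> set P2) : set ('I_n -> set P2) :=
  [set B | exists2 g, PGL3 g & B = (fun l => g @` A l)].

Definition ordered_moduli_space : set (set ('I_n -> set P2)) :=
  [set PGL3_orbit A | A in ordered_realizations].

End Realizations.

Definition arrangementC (g : C) : 'I_10 -> set P2 := tnth
  [tuple locus (fun x y z => z = 0);
         locus (fun x y z => x = 0);
         locus (fun x y z => x = z);
         locus (fun x y z => x = - (g + 1) * z);
         locus (fun x y z => x = (g + 2) * z);
         locus (fun x y z => y = x);
         locus (fun x y z => y = g * (x - z));
         locus (fun x y z => y = g * x + z);
         locus (fun x y z => y = z);
         locus (fun x y z => y = 0)].

End ProjectivePlane.

Arguments ordered_realizations R {n} K.
Arguments ordered_moduli_space R {n} K.

(* Main.v *)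
Require Import Defs.
From HB Require Import structures.
From mathcomp Require Import all_boot all_order all_algebra.
From mathcomp Require Import complex.
From mathcomp Require Import boolp classical_sets functions cardinality reals.
From mathcomp Require Import ring.

Set Implicit Arguments.
Unset Strict Implicit.
Unset Printing Implicit Defensive.

Import Order.TTheory GRing.Theory Num.Theory.
Local Open Scope classical_set_scope.
Local Open Scope ring_scope.

(** The moduli space is computed with homogeneous coordinates: a point of the
    plane is spanned by a row vector v, a line is the annihilator of a column
    vector c (its covector), and v lies on c when v *m c = 0.  An ordered
    realization of a combinatorics is then a choice of nonzero vectors and
    covectors with the prescribed incidences (realization_coordinates,
    coordinates_realization), and the orbit of an arrangement of lines under
    PGL(3) is obtained by multiplying all its covectors by one invertible
    matrix (PGL3_orbit_lineE).

    Every realization has a golden normal form (coordinates_normal_form).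
    The four points M1 M2 M3 M4 M5, M1 L4 L5, M2 L1 L5 and M3 L1 L4 are in
    general position, because the lines joining two of them are M1, M2, M3,
    L1, L4, L5 and none of these contains a third one.  A change of
    coordinates sends them to [0:1:0], [1:0:0], [0:0:1] and [1:1:1]
    (projective_frame), which determines these six lines.  In the coordinates of
    the affine chart z = 1, the lines M4 and M5 are vertical,
    L2 passes through (1, 0) and L3 through (0, 1), with a common slope g as
    they meet on M1, the line at infinity.  The points M4 L1 L2 and M4 L3 L5 say
    that M4 is x = - (g + 1) and that g ^+ 2 + g - 1 = 0; the points M5 L1 L3
    and M5 L2 L4 then say that M5 is x = g + 2.

    Conversely both roots give realizations (coordinatizesC).  All incidences
    are statements about elements of the ring Z[g], which are decided by
    computing with pairs of integers: an element vanishes when both its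
    coordinates do, and is nonzero when its norm is.

    Finally the two orbits differ (arrangementC_orbit_inj): a matrix that maps
    one arrangement to the other fixes the four points of the frame, hence is
    scalar, and so L2 has the same slope in both. *)

(** * Vectors and covectors in dimension 3 *)

Section Coordinates.
Variable F : fieldType.
Implicit Types (u v : 'rV[F]_3) (c d : 'cV[F]_3).

Definition row3 (x y z : F) : 'rV[F]_3 := \row_j [:: x; y; z]`_j.
Definition col3 (x y z : F) : 'cV[F]_3 := \col_i [:: x; y; z]`_i.

Lemma row3E x y z : (row3 x y z 0 0 = x) * (row3 x y z 0 1 = y) *
  (row3 x y z 0 2 = z).
Proof. by rewrite !mxE. Qed.

Lemma col3E x y z : (col3 x y z 0 0 = x) * (col3 x y z 1 0 = y) *
  (col3 x y z 2 0 = z).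
Proof. by rewrite !mxE. Qed.

Lemma big_ord3 (V : nmodType) (f : 'I_3 -> V) :
  \sum_i f i = f 0 + f 1 + f 2.
Proof.
rewrite !big_ord_recr big_ord0 /= add0r.
by congr (f _ + f _ + f _); apply: val_inj.
Qed.

Lemma ord3P (P : 'I_3 -> Prop) : P 0 -> P 1 -> P 2 -> forall i, P i.
Proof.
move=> P0 P1 P2 [[|[|[|//]]] i3].
- by rewrite (_ : Ordinal i3 = 0) //; apply: val_inj.
- by rewrite (_ : Ordinal i3 = 1) //; apply: val_inj.
by rewrite (_ : Ordinal i3 = 2) //; apply: val_inj.
Qed.

Lemma row3_surj v : v = row3 (v 0 0) (v 0 1) (v 0 2).
Proof. by apply/rowP; apply: ord3P; rewrite row3E. Qed.

Lemma col3_surj c : c = col3 (c 0 0) (c 1 0) (c 2 0).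
Proof. by apply/colP; apply: ord3P; rewrite col3E. Qed.

Lemma incident3E v c :
  (v *m c == 0) = (v 0 0 * c 0 0 + v 0 1 * c 1 0 + v 0 2 * c 2 0 == 0).
Proof.
apply/eqP/eqP => [/matrixP/(_ 0 0)|vc0]; first by rewrite !mxE big_ord3.
by apply/matrixP => i j; rewrite !ord1 !mxE big_ord3.
Qed.

Lemma incident_col3 v (x y z : F) :
  (v *m col3 x y z == 0) = (v 0 0 * x + v 0 1 * y + v 0 2 * z == 0).
Proof. by rewrite incident3E !col3E. Qed.

Lemma row3_eq0 x y z : (row3 x y z == 0) = [&& x == 0, y == 0 & z == 0].
Proof.
apply/eqP/and3P => [/rowP v0|[/eqP-> /eqP-> /eqP->]].
  by have := (v0 0, v0 1, v0 2); rewrite !row3E !mxE => -[[-> ->] ->].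
by apply/rowP; apply: ord3P; rewrite row3E mxE.
Qed.

Lemma col3_eq0 x y z : (col3 x y z == 0) = [&& x == 0, y == 0 & z == 0].
Proof.
apply/eqP/and3P => [/colP v0|[/eqP-> /eqP-> /eqP->]].
  by have := (v0 0, v0 1, v0 2); rewrite !col3E !mxE => -[[-> ->] ->].
by apply/colP; apply: ord3P; rewrite col3E mxE.
Qed.

Definition proportional (e c : 'cV[F]_3) := exists2 k, k != 0 & c = k *: e.

(** The conclusion is the vanishing of the 3 x 3 determinant whose rows are the
    three covectors. Multiplying it by a coordinate of [u] gives a combination,
    with 2 x 2 minors as coefficients, of the three incidences (Cramer). *)
Lemma concurrent_det3 u x1 y1 z1 x2 y2 z2 x3 y3 z3 : u != 0 ->
  u *m col3 x1 y1 z1 = 0 -> u *m col3 x2 y2 z2 = 0 -> u *m col3 x3 y3 z3 = 0 ->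
  x1 * (y2 * z3 - z2 * y3) - y1 * (x2 * z3 - z2 * x3)
  + z1 * (x2 * y3 - y2 * x3) = 0.
Proof.
move=> u0 /eqP + /eqP + /eqP; rewrite !incident_col3.
move=> /eqP h1 /eqP h2 /eqP h3.
set D := (X in X = 0).
have [//|D0] := eqVneq D 0; case/eqP: u0.
rewrite (row3_surj u); apply/eqP; rewrite row3_eq0.
have D0P x : x * D = 0 -> x == 0.
  by move/eqP; rewrite mulf_eq0 (negPf D0) orbF.
apply/and3P; split; apply: D0P.
- transitivity ((u 0 0 * x1 + u 0 1 * y1 + u 0 2 * z1)
      * (y2 * z3 - z2 * y3)
    - (u 0 0 * x2 + u 0 1 * y2 + u 0 2 * z2)
      * (y1 * z3 - z1 * y3)
    + (u 0 0 * x3 + u 0 1 * y3 + u 0 2 * z3)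
      * (y1 * z2 - z1 * y2)).
    by rewrite /D; ring.
  by rewrite h1 h2 h3; ring.
- transitivity (- (u 0 0 * x1 + u 0 1 * y1 + u 0 2 * z1)
      * (x2 * z3 - z2 * x3)
    + (u 0 0 * x2 + u 0 1 * y2 + u 0 2 * z2)
      * (x1 * z3 - z1 * x3)
    - (u 0 0 * x3 + u 0 1 * y3 + u 0 2 * z3)
      * (x1 * z2 - z1 * x2)).
    by rewrite /D; ring.
  by rewrite h1 h2 h3; ring.
transitivity ((u 0 0 * x1 + u 0 1 * y1 + u 0 2 * z1)
    * (x2 * y3 - y2 * x3)
  - (u 0 0 * x2 + u 0 1 * y2 + u 0 2 * z2)
    * (x1 * y3 - y1 * x3)
  + (u 0 0 * x3 + u 0 1 * y3 + u 0 2 * z3)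
    * (x1 * y2 - y1 * x2)).
  by rewrite /D; ring.
by rewrite h1 h2 h3; ring.
Qed.

(** Four points in general position can be sent to the standard projective
    frame. The general position of [w 0], [w 1], [w 2] is expressed by the
    sides [h] of the triangle that they form, [h j] being opposite to [w j];
    that of [w3] by its lying on none of these sides. Rescaling the [w i] so
    that they add up to [w3] is possible since the coordinates of [w3] in the
    basis [w] are the pairings with the [h j], up to nonzero factors. *)
Lemma projective_frame (w : 'I_3 -> 'rV[F]_3) (h : 'I_3 -> 'cV[F]_3)
    (w3 : 'rV[F]_3) :
    (forall i j, (w i *m h j == 0) = (i != j)) ->
    (forall j, w3 *m h j != 0) ->
  exists2 X : 'M[F]_3, X \in unitmx &
    w3 = (const_mx 1 : 'rV_3) *m X /\
    forall i, exists2 k, k != 0 & row i X = k *: w i.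
Proof.
move=> wh w3h.
pose W : 'M[F]_3 := \matrix_i w i.
have rowW i : row i W = w i by apply: rowK.
have combine (b : 'rV[F]_3) j : b *m W *m h j = b 0 j *: (w j *m h j).
  rewrite [b *m W]mulmx_sum_row mulmx_suml (bigD1 j) //= rowW -scalemxAl.
  rewrite big1 ?addr0 // => i ij; rewrite rowW -scalemxAl.
  by move: (wh i j); rewrite ij => /eqP ->; rewrite scaler0.
have Wunit : W \in unitmx.
  rewrite -row_free_unit -kermx_eq0; apply/rowV0P => a.
  move/sub_kermxP; rewrite mulmx_sum_row => aW0.
  apply/rowP => j; rewrite mxE.
  have : a *m W *m h j = 0 by rewrite [a *m W]mulmx_sum_row aW0 mul0mx.
  rewrite combine => /eqP; rewrite scaler_eq0 wh eqxx orbF => /eqP //.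
pose a := w3 *m invmx W.
have a0 j : a 0 j != 0.
  apply: contraNneq (w3h j) => aj0.
  by rewrite -(mulmxKV Wunit w3) combine aj0 scale0r.
exists (diag_mx a *m W).
  rewrite unitmx_mul Wunit andbT unitmxE det_diag unitfE.
  by apply/prodf_neq0 => i _.
split=> [|i].
  rewrite mulmxA mul_mx_diag -[LHS](mulmxKV Wunit); congr (_ *m _).
  by apply/rowP => j; rewrite !mxE mul1r.
exists (a 0 i) => //.
by rewrite row_mul row_diag_mx -scalemxAl -rowE rowW.
Qed.

End Coordinates.

(** * Lines of the projective plane and their images under PGL(3) *)

Section Plane.
Variable R : realType.
Local Notation C := R[i].

Definition line (c : 'cV[C]_3) : set (P2 R) :=
  [set p : P2 R | forall v : 'rV[C]_3, v \in val p -> v *m c = 0].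

Lemma P2_span (p : P2 R) : exists2 v, v != 0 & val p = <[v]>%VS.
Proof.
have dp := eqP (valP p); exists (vpick (val p)).
  by rewrite vpick0 -dimv_eq0 dp.
apply/esym/eqP; rewrite eqEdim dp dim_vline vpick0 -dimv_eq0 dp andbT.
by rewrite -memvE memv_pick.
Qed.

Lemma span_P2 (v : 'rV[C]_3) : v != 0 -> exists p : P2 R, val p = <[v]>%VS.
Proof.
move=> v0; have dv : \dim <[v]> == 1%N by rewrite dim_vline v0.
by exists (exist (fun V => is_true (\dim V == 1%N)) <[v]>%VS dv).
Qed.

Lemma line_span {p : P2 R} {v} c :
  val p = <[v]>%VS -> line c p <-> v *m c = 0.
Proof.
move=> pv; split=> [|vc u]; first by apply; rewrite pv memv_line.
by rewrite pv => /vlineP[k ->]; rewrite -scalemxAl vc scaler0.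
Qed.

Lemma line_col3 (E : C -> C -> C -> Prop) a b c :
  (forall x y z, E x y z <-> x * a + y * b + z * c = 0) ->
  locus E = line (col3 a b c).
Proof.
move=> Eabc; apply/seteqP; split=> p pE v /pE.
  by rewrite Eabc => vE; apply/eqP; rewrite incident_col3 vE.
by move/eqP; rewrite incident_col3 Eabc => /eqP.
Qed.

Lemma line_equation (f h : C -> C -> C -> C) a b c :
  (forall x y z, f x y z - h x y z = x * a + y * b + z * c) ->
  locus (fun x y z => f x y z = h x y z) = line (col3 a b c).
Proof.
move=> fh; apply: line_col3 => x y z; rewrite -fh.
by split=> [->|/eqP]; rewrite ?subrr // subr_eq0 => /eqP.
Qed.

Lemma line_proportional e c : proportional e c -> line c = line e.
Proof.
move=> [k k0 ->]; apply/seteqP; split=> p ep v /ep.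
  by rewrite -scalemxAr => /eqP; rewrite scaler_eq0 (negPf k0) => /eqP.
by rewrite -scalemxAr => ->; rewrite scaler0.
Qed.

Lemma line_eq_incident (c d : 'cV[C]_3) (v : 'rV[C]_3) :
  line c = line d -> v *m c = 0 -> v *m d = 0.
Proof.
move=> cd vc; have [->|v0] := eqVneq v 0; first by rewrite mul0mx.
have [p pv] := span_P2 v0; apply/(line_span _ pv).
by rewrite -cd; apply/(line_span _ pv).
Qed.

Lemma is_line_line c : c != 0 -> is_line (line c).
Proof.
move=> c0; exists (c 0 0), (c 1 0), (c 2 0); split.
  apply: contraNneq c0 => -[cx cy cz].
  by rewrite (col3_surj c) col3_eq0 cx cy cz !eqxx.
rewrite [in LHS](col3_surj c); apply/esym/line_col3 => x y z.
by rewrite (mulrC x) (mulrC y) (mulrC z).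
Qed.

Lemma line_of_is_line l : is_line l -> exists2 c, c != 0 & l = line c.
Proof.
move=> [a [b [c [abc0 ->]]]]; exists (col3 a b c).
  apply: contraNneq abc0 => /eqP.
  by rewrite col3_eq0 => /and3P[/eqP-> /eqP-> /eqP->].
by apply: line_col3 => x y z; rewrite (mulrC x) (mulrC y) (mulrC z).
Qed.

Lemma image_span (X : 'M[C]_3) (v : 'rV[C]_3) :
  (linfun (mulmxr X) @: <[v]>)%VS = <[v *m X]>%VS.
Proof. by rewrite limg_line lfunE. Qed.

Lemma unitmx_mul_neq0 (X : 'M[C]_3) (v : 'rV[C]_3) :
  X \in unitmx -> v != 0 -> v *m X != 0.
Proof.
by move=> Xu; apply: contraNneq => vX; rewrite -(mulmxK Xu v) vX mul0mx.
Qed.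

(** Vectors are multiplied by [X] on the right, so covectors are multiplied by
    its inverse on the left. *)
Lemma PGL3_image_line (g : P2 R -> P2 R) (X : 'M[C]_3) c : X \in unitmx ->
    (forall p, val (g p) = (linfun (mulmxr X) @: val p)%VS) ->
  g @` line c = line (invmx X *m c).
Proof.
move=> Xu gX; apply/seteqP; split=> [_ [p pc <-]|q qc].
  have [v v0 pv] := P2_span p.
  have gpv : val (g p) = <[v *m X]>%VS by rewrite gX pv image_span.
  by apply/(line_span _ gpv); rewrite mulmxA mulmxK //; apply/(line_span _ pv).
have [v v0 qv] := P2_span q.
have [|p pv] := @span_P2 (v *m invmx X).
  by apply: unitmx_mul_neq0; rewrite ?unitmx_inv.
exists p.
  by apply/(line_span _ pv); rewrite -mulmxA; apply/(line_span _ qv).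
by apply: val_inj; rewrite gX pv image_span mulmxKV.
Qed.

Lemma line_mulmx_image (X : 'M[C]_3) : X \in unitmx ->
  exists2 g : P2 R -> P2 R, PGL3 g & forall c, line (X *m c) = g @` line c.
Proof.
move=> Xu; have Yu : invmx X \in unitmx by rewrite unitmx_inv.
have /choice[g gX] (p : P2 R) : exists q : P2 R,
    val q = (linfun (mulmxr (invmx X)) @: val p)%VS.
  have [v v0 ->] := P2_span p.
  by rewrite image_span; apply: span_P2; apply: unitmx_mul_neq0.
exists g; first by exists (invmx X).
by move=> c; rewrite (PGL3_image_line _ Yu gX) invmxK.
Qed.

Lemma PGL3_orbit_lineE n (c : 'I_n -> 'cV[C]_3) (B : 'I_n -> set (P2 R)) :
  PGL3_orbit (fun l => line (c l)) B <->
  exists2 X : 'M[C]_3, X \in unitmx & B = fun l => line (X *m c l).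
Proof.
split=> [[g [X Xu gX] ->]|[X Xu ->]].
  exists (invmx X); rewrite ?unitmx_inv //.
  by apply/funext => l; apply: PGL3_image_line.
have [g gP gX] := line_mulmx_image Xu.
by exists g => //; apply/funext => l; rewrite gX.
Qed.

Lemma PGL3_orbit_line_eq n (c d : 'I_n -> 'cV[C]_3) :
  PGL3_orbit (fun l => line (c l)) = PGL3_orbit (fun l => line (d l)) <->
  exists2 X : 'M[C]_3, X \in unitmx & forall l, line (d l) = line (X *m c l).
Proof.
split=> [cd|[X Xu dX]].
  have : PGL3_orbit (fun l => line (d l)) (fun l => line (d l)).
    apply/PGL3_orbit_lineE; exists 1%:M; first exact: unitmx1.
    by apply/funext => l; rewrite mul1mx.
  rewrite -cd => /PGL3_orbit_lineE[X Xu dX]; exists X => // l.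
  exact: (congr1 (@^~ l) dX).
have imY Y l : Y \in unitmx -> line (Y *m d l) = line (Y *m (X *m c l)).
  by move=> /line_mulmx_image[g _ gY]; rewrite !gY dX.
apply/seteqP; split=> B /PGL3_orbit_lineE[Y Yu ->]; apply/PGL3_orbit_lineE.
  exists (Y *m invmx X); first by rewrite unitmx_mul Yu unitmx_inv.
  apply/funext => l; rewrite imY ?unitmx_mul ?Yu ?unitmx_inv //.
  by rewrite -mulmxA mulKmx.
exists (Y *m X); first by rewrite unitmx_mul Yu.
by apply/funext => l; rewrite imY // mulmxA.
Qed.

(** * Realizations as systems of vectors and covectors *)

Section Realizations.
Variables (n : nat) (K : ordered_line_combinatorics n).

Definition coordinatizes (c : 'I_n -> 'cV[C]_3) (w : points K -> 'rV[C]_3) :=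
  [/\ forall l, c l != 0, forall p, w p != 0 &
      forall p l, (w p *m c l == 0) = inc p l].

Lemma realization_coordinates (A : 'I_n -> set (P2 R)) :
    ordered_realizations R K A ->
  exists c w, A = (fun l => line (c l)) /\ coordinatizes c w.
Proof.
move=> [lineA _ [f _ fA]].
have /choice[c cA] l : exists c, c != 0 /\ A l = line c.
  by have [c] := line_of_is_line (lineA l); exists c.
have /choice[w wf] p : exists v, v != 0 /\ val (f p) = <[v]>%VS.
  by have [v] := P2_span (f p); exists v.
exists c, w; split; first by apply/funext => l; case: (cA l).
split=> [l|p|p l]; [by case: (cA l)|by case: (wf p)|].
apply/eqP/idP => [wc|pl]; [apply/fA|move/fA: pl]; rewrite (cA l).2.
  exact/(line_span _ (wf p).2).
by move/(line_span _ (wf p).2).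
Qed.

(** The vector [q] witnesses that the lines [c] and [c'] differ: the plane
    annihilated by [c] is not contained in the one annihilated by [c'], so that
    their intersection has dimension at most 1. *)
Lemma two_lines_meet_once (c c' : 'cV[C]_3) (u v q : 'rV[C]_3) : c != 0 ->
    q *m c = 0 -> q *m c' != 0 -> u != 0 -> v != 0 ->
    u *m c = 0 -> u *m c' = 0 -> v *m c = 0 -> v *m c' = 0 ->
  <[u]>%VS = <[v]>%VS.
Proof.
move=> c0 qc qc' u0 v0 uc uc' vc vc'.
pose I := (kermx c :&: kermx c')%MS.
have rI : (\rank I <= 1)%N.
  have rc : \rank c = 1%N.
    by apply/eqP; rewrite eqn_leq rank_leq_col lt0n mxrank_eq0.
  rewrite -ltnS; apply: (@leq_trans (\rank (kermx c))); last first.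
    by rewrite mxrank_ker rc.
  apply: rank_ltmx; rewrite ltmxE capmxSl /=.
  apply: contra qc' => kI; apply/eqP/sub_kermxP.
  apply: submx_trans (capmxSr (kermx c) _); apply: submx_trans kI.
  exact/sub_kermxP.
have uI : (u <= I)%MS by rewrite sub_capmx; apply/andP; split; apply/sub_kermxP.
have vI : (v <= I)%MS by rewrite sub_capmx; apply/andP; split; apply/sub_kermxP.
suff /eqmxP uv : (u == v)%MS.
  have /sub_rVP[k uk] : (u <= v)%MS by rewrite uv.
  rewrite uk; apply/esym/eqP; rewrite eqEdim !dim_vline v0 -uk u0 andbT.
  rewrite -memvE; apply/vlineP; exists k^-1.
  rewrite uk scalerA mulVf ?scale1r //.
  by apply: contraNneq u0 => k0; rewrite uk k0 scale0r.
have eqI (x : 'rV[C]_3) : x != 0 -> (x <= I)%MS -> (x == I)%MS.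
  move=> x0 xI; case: (mxrank_leqif_eq xI) => le <-.
  by rewrite eqn_leq le rank_rV x0.
apply/eqmxP; apply: eqmx_trans (eqmxP (eqI u u0 uI)) _.
exact/eqmx_sym/eqmxP/eqI.
Qed.

(** The incidences determine everything. A point of the combinatorics that is on
    [l] and not on [l'] makes these two lines of the plane distinct. Distinct
    lines meet only once, so the given vectors account for all the multiple
    points; and a point is recovered from any two of its lines. *)
Lemma coordinates_realization c w :
    (forall l l' : 'I_n, l != l' ->
      exists p : points K, inc p l && ~~ inc p l') ->
    coordinatizes c w ->
  ordered_realizations R K (fun l => line (c l)).
Proof.
move=> sepK [c0 w0 wc].
have /choice[f fw] p : exists q : P2 R, val q = <[w p]>%VS by apply: span_P2.
have fcE p l : line (c l) (f p) <-> inc p l.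
  rewrite -wc; split=> [/(line_span _ (fw p))/eqP//|/eqP wc0].
  exact/(line_span _ (fw p)).
split=> [l|l l' cll'|]; first exact: is_line_line.
  apply: contrapT => /eqP /sepK[p /andP[/fcE pl /negP]].
  by apply; apply/fcE; rewrite -cll'.
exists f => //; split=> [p _|p q _ _ fpq|q [l [l' [ll' ql ql']]]].
- have [l [l' [ll' pl pl']]] := inc_point p.
  by exists l, l'; split=> //; apply/fcE.
- have [l [l' [ll' pl pl']]] := inc_point p.
  have [r [_ rU]] := inc_meet K ll'.
  rewrite -(rU p) // (rU q) //.
  by split; apply/fcE; rewrite -fpq; apply/fcE.
have [p [[pl pl'] _]] := inc_meet K ll'.
have [v v0 qv] := P2_span q.
have [r /andP[]] := sepK _ _ ll'; rewrite -!wc => /eqP rl rl'.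
move: pl pl'; rewrite -!wc => /eqP pl /eqP pl'.
exists p => //; apply: val_inj; rewrite fw qv.
by apply: (two_lines_meet_once (c0 l) rl rl') => //; apply/(line_span _ qv).
Qed.

End Realizations.
End Plane.

(** * The ring generated by a root of X^2 + X - 1 *)

(** The pair (a, b) of integers stands for the number a + b g. *)
Section GoldenIntegers.
Variables (F : numDomainType) (g : F).
Hypothesis g_root : g ^+ 2 + g - 1 = 0.

Definition golden_eval (a : int * int) : F := a.1%:~R + a.2%:~R * g.

Definition golden_add (a b : int * int) : int * int := (a.1 + b.1, a.2 + b.2).

Definition golden_mul (a b : int * int) : int * int :=
  (a.1 * b.1 + a.2 * b.2, a.1 * b.2 + a.2 * b.1 - a.2 * b.2).

(** The product of a + b g and its conjugate a + b (- 1 - g). *)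
Definition golden_norm (a : int * int) : int :=
  a.1 ^+ 2 - a.1 * a.2 - a.2 ^+ 2.

Lemma golden_evalD a b :
  golden_eval (golden_add a b) = golden_eval a + golden_eval b.
Proof. by rewrite /golden_eval /= !intrD; ring. Qed.

Lemma golden_evalM a b :
  golden_eval (golden_mul a b) = golden_eval a * golden_eval b.
Proof.
rewrite /golden_eval /= !(intrD, intrB, intrM).
rewrite -[LHS]addr0 -[X in _ + X](mulr0 (a.2%:~R * b.2%:~R)) -g_root.
by ring.
Qed.

(** As the norm is an integer, this turns the nonvanishing of a number of the
    ring into a computation. *)
Lemma golden_eval_eq0 a : golden_eval a = 0 -> golden_norm a = 0.
Proof.
move=> a0; apply/eqP; rewrite -(intr_eq0 F).
rewrite /golden_norm !(intrD, intrB, intrM, rmorphXn) /=.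
rewrite -[X in X == 0]addr0 -[X in _ + X](mulr0 (- a.2%:~R ^+ 2)) -g_root.
apply/eqP; transitivity (golden_eval a * (a.1%:~R - a.2%:~R * (g + 1))).
  by rewrite /golden_eval; ring.
by rewrite a0 mul0r.
Qed.

End GoldenIntegers.

(** * The arrangement attached to a root *)

Local Notation M1 := (Ordinal (isT : 0 < 10)%N).
Local Notation M2 := (Ordinal (isT : 1 < 10)%N).
Local Notation M3 := (Ordinal (isT : 2 < 10)%N).
Local Notation M4 := (Ordinal (isT : 3 < 10)%N).
Local Notation M5 := (Ordinal (isT : 4 < 10)%N).
Local Notation L1 := (Ordinal (isT : 5 < 10)%N).
Local Notation L2 := (Ordinal (isT : 6 < 10)%N).
Local Notation L3 := (Ordinal (isT : 7 < 10)%N).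
Local Notation L4 := (Ordinal (isT : 8 < 10)%N).
Local Notation L5 := (Ordinal (isT : 9 < 10)%N).
(* 'P_k is the k-th entry of the list of the points, counted from 0. *)
Local Notation "'P_ k" := (Ordinal (isT : k < 16)%N)
  (at level 8, k at level 2, format "''P_' k").

Section Arrangement.
Variable R : realType.
Local Notation C := R[i].

(** The covectors of the ten lines and, below, the vectors of the sixteen
    points, with coordinates a + b g written as pairs (a, b). *)
Definition covectors_golden : seq ((int * int) * (int * int) * (int * int)) :=
  [:: ((0, 0), (0, 0), (1, 0)); ((1, 0), (0, 0), (0, 0));
      ((1, 0), (0, 0), (-1, 0)); ((1, 0), (0, 0), (1, 1));
      ((1, 0), (0, 0), (-2, -1)); ((-1, 0), (1, 0), (0, 0));
      ((0, -1), (1, 0), (0, 1)); ((0, -1), (1, 0), (-1, 0));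
      ((0, 0), (1, 0), (-1, 0)); ((0, 0), (1, 0), (0, 0))].

Definition vectors_golden : seq ((int * int) * (int * int) * (int * int)) :=
  [:: ((0, 0), (1, 0), (0, 0));
      ((1, 0), (0, 1), (0, 0)); ((1, 0), (0, 0), (0, 0));
      ((0, 0), (0, 0), (1, 0)); ((0, 0), (1, 0), (1, 0));
      ((1, 0), (1, 0), (1, 0)); ((1, 0), (0, 0), (1, 0));
      ((-1, -1), (-1, -1), (1, 0)); ((-1, -1), (0, 0), (1, 0));
      ((2, 1), (2, 1), (1, 0)); ((2, 1), (1, 0), (1, 0));
      ((1, 0), (1, 0), (0, 0)); ((0, 0), (0, -1), (1, 0));
      ((1, 0), (1, 1), (1, 0)); ((-1, -1), (1, 0), (1, 0));
      ((2, 1), (0, 0), (1, 0))].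

Definition golden_dot (a b : (int * int) * (int * int) * (int * int)) :=
  golden_add (golden_add (golden_mul a.1.1 b.1.1) (golden_mul a.1.2 b.1.2))
    (golden_mul a.2 b.2).

(** The left-hand sides minus the right-hand sides of the equations of the ten
    lines. *)
Definition covectorC (g : C) : 'I_10 -> 'cV[C]_3 := tnth
  [tuple col3 0 0 1; col3 1 0 0; col3 1 0 (-1); col3 1 0 (g + 1);
         col3 1 0 (- (g + 2)); col3 (-1) 1 0; col3 (- g) 1 g;
         col3 (- g) 1 (-1); col3 0 1 (-1); col3 0 1 0].

Definition vectorC (g : C) (p : 'I_16) : 'rV[C]_3 :=
  let a := nth (0, 0, 0) vectors_golden p in
  row3 (golden_eval g a.1.1) (golden_eval g a.1.2) (golden_eval g a.2).

Lemma covectorCE g (l : 'I_10) : let a := nth (0, 0, 0) covectors_golden l in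
  covectorC g l =
  col3 (golden_eval g a.1.1) (golden_eval g a.1.2) (golden_eval g a.2).
Proof.
by case: l => [[|[|[|[|[|[|[|[|[|[|//]]]]]]]]]] ?];
   rewrite /covectorC (tnth_nth 0) /golden_eval /=; congr col3; ring.
Qed.

Lemma arrangementCE g : arrangementC g = fun l => line (covectorC g l).
Proof.
apply/funext => -[[|[|[|[|[|[|[|[|[|[|//]]]]]]]]]] ?];
  rewrite /arrangementC /covectorC (tnth_nth set0) (tnth_nth 0) /=;
  by apply: line_equation => x y z; ring.
Qed.

(** Asking for the zero pair at an incidence and for a nonzero norm elsewhere
    makes the 160 cases independent of the root, hence decidable by
    evaluation. *)
Lemma incidence_golden (p : 'I_16) (l : 'I_10) :
  let a := golden_dot (nth (0, 0, 0) vectors_golden p)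
                      (nth (0, 0, 0) covectors_golden l) in
  if incC p l then a == (0, 0) else golden_norm a != 0.
Proof.
rewrite /incC (tnth_nth [::]).
case: l => [[|[|[|[|[|[|[|[|[|[|//]]]]]]]]]] ?];
by case: p => [[|[|[|[|[|[|[|[|[|[|[|[|[|[|[|[|//]]]]]]]]]]]]]]]] ?];
   vm_compute.
Qed.

Lemma incC_separated (l l' : 'I_10) : l != l' ->
  exists p, incC p l && ~~ incC p l'.
Proof.
move=> ll'.
have : (l != l') ==>
    has (fun s : seq 'I_10 => (l \in s) && (l' \notin s)) pointsC.
  case: l {ll'} => [[|[|[|[|[|[|[|[|[|[|//]]]]]]]]]] ?];
  by case: l' => [[|[|[|[|[|[|[|[|[|[|//]]]]]]]]]] ?]; vm_compute.
by rewrite ll' => /hasP[s /tnthP[p ->]]; exists p.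
Qed.

Lemma coordinatizesC (g : C) : g ^+ 2 + g - 1 = 0 ->
  coordinatizes (K := combinatoricsC) (covectorC g) (vectorC g).
Proof.
move=> g_root.
have wc (p : 'I_16) l : (vectorC g p *m covectorC g l == 0) = incC p l.
  rewrite covectorCE incident_col3 !row3E -!golden_evalM // -!golden_evalD.
  (* The pairing is now the value at g of an explicit pair of integers. *)
  have := incidence_golden p l; rewrite /golden_dot.
  case: incC => [/eqP->|]; first by rewrite /golden_eval mul0r addr0 eqxx.
  by apply: contraNF => /eqP/golden_eval_eq0->.
split=> // [l|p].
  by case: l => [[|[|[|[|[|[|[|[|[|[|//]]]]]]]]]] ?];
     rewrite /covectorC (tnth_nth 0) /= col3_eq0 oner_eq0 ?andbF.
(* A zero vector would be on every line. *)
have [l] : exists l, ~~ incC p l.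
  have : has (fun l => ~~ incC p l) [:: M1; M2; L1; L2].
    by case: p => [[|[|[|[|[|[|[|[|[|[|[|[|[|[|[|[|//]]]]]]]]]]]]]]]] ?];
       vm_compute.
  by case/hasP => l _; exists l.
by rewrite -wc; apply: contraNneq => ->; rewrite mul0mx.
Qed.

End Arrangement.

(** * The normal form of a realization *)

Section Classification.
Variable R : realType.
Local Notation C := R[i].

Lemma proportional_col3 (c : 'cV[C]_3) k x y z : k != 0 ->
    c 0 0 = k * x -> c 1 0 = k * y -> c 2 0 = k * z ->
  proportional (col3 x y z) c.
Proof.
move=> k0 cx cy cz; exists k => //.
by apply/colP; apply: ord3P; rewrite mxE col3E.
Qed.

(** In the coordinates of the frame, a line contains [1:0:0], [0:1:0] or [0:0:1]
    when the corresponding coordinate of its covector vanishes, and [1:1:1]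
    when their sum does. *)
Lemma frame_coordinates c w :
    coordinatizes (R := R) (K := combinatoricsC) c w ->
  exists2 X : 'M[C]_3, X \in unitmx &
    forall l, let d := X *m c l in
    [/\ (d 0 0 == 0) = incC 'P_2 l, (d 1 0 == 0) = incC 'P_0 l,
        (d 2 0 == 0) = incC 'P_3 l &
        (d 0 0 + d 1 0 + d 2 0 == 0) = incC 'P_5 l].
Proof.
move=> [_ _ incw].
have wc p l : (w p *m c l == 0) = incC p l := incw p l.
pose f i := tnth [tuple 'P_2; 'P_0; 'P_3] i.
(* The sides of the triangle 2, 0, 3, each opposite to the point of f. *)
pose h i := tnth [tuple M2; L5; M1] i.
have [||X Xu [w5 wX]] :=
    @projective_frame _ (fun i => w (f i)) (fun j => c (h j)) (w 'P_5).
- by apply: ord3P; apply: ord3P; rewrite wc; vm_compute.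
- by apply: ord3P; rewrite wc; vm_compute.
exists X => // l; set d := X *m c l; cbv zeta.
have dE i : (d i 0 == 0) = incC (f i) l.
  have [k k0 Xi] := wX i; rewrite -wc.
  have -> : d i 0 = row i d 0 0 by rewrite [RHS]mxE.
  rewrite /d row_mul Xi -scalemxAl [X in X == 0]mxE.
  rewrite mulf_eq0 (negPf k0); apply/eqP/eqP => [wc0|->]; last by rewrite mxE.
  by apply/matrixP => a b; rewrite !ord1 wc0 mxE.
rewrite !dE; split=> //.
by rewrite -wc w5 -mulmxA incident3E !mxE !mul1r.
Qed.

(** The six lines through two points of the frame are determined by it. The
    remaining M4, M5, L2, L3 are given by six unknowns, on which the seven
    triple points other than those of the frame impose determinantal equations;
    these express everything through the slope of L2, a root of X^2 + X - 1. *)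
Lemma coordinates_normal_form c w :
    coordinatizes (R := R) (K := combinatoricsC) c w ->
  exists2 X : 'M[C]_3, X \in unitmx &
  exists2 g : C, g ^+ 2 + g - 1 = 0 &
    forall l, proportional (covectorC g l) (X *m c l).
Proof.
move=> cw; have [X Xu dE] := frame_coordinates cw.
exists X => //; pose d l := X *m c l.
have [x0 y0 z0 s0] : [/\ forall l, incC 'P_2 l -> d l 0 0 = 0,
    forall l, incC 'P_0 l -> d l 1 0 = 0, forall l, incC 'P_3 l -> d l 2 0 = 0
    & forall l, incC 'P_5 l -> d l 0 0 + d l 1 0 + d l 2 0 = 0].
  split=> l pl; have [ex ey ez es] := dE l;
  by apply/eqP; rewrite ?(ex, ey, ez, es).
have [x1 y1 z1] : [/\ forall l, ~~ incC 'P_2 l -> d l 0 0 != 0,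
    forall l, ~~ incC 'P_0 l -> d l 1 0 != 0
    & forall l, ~~ incC 'P_3 l -> d l 2 0 != 0].
  by split=> l pl; have [ex ey ez _] := dE l; rewrite ?(ex, ey, ez).
have conc p l1 l2 l3 a1 b1 c1 a2 b2 c2 a3 b3 c3 :
    proportional (col3 a1 b1 c1) (d l1) ->
    proportional (col3 a2 b2 c2) (d l2) ->
    proportional (col3 a3 b3 c3) (d l3) ->
    [&& incC p l1, incC p l2 & incC p l3] ->
  a1 * (b2 * c3 - c2 * b3) - b1 * (a2 * c3 - c2 * a3)
  + c1 * (a2 * b3 - b2 * a3) = 0.
  move=> d1 d2 d3 /and3P[p1 p2 p3]; have [_ w0 wc] := cw.
  have wXe l e : incC p l -> proportional e (d l) -> w p *m invmx X *m e = 0.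
    move=> pl [k k0 de]; apply/eqP.
    have /eqP : w p *m invmx X *m d l == 0 by rewrite mulmxA mulmxKV // wc.
    by rewrite de -scalemxAr => /eqP; rewrite scaler_eq0 (negPf k0).
  apply: (concurrent_det3 _ (wXe _ _ p1 d1) (wXe _ _ p2 d2) (wXe _ _ p3 d3)).
  by apply: unitmx_mul_neq0; rewrite ?unitmx_inv.
(* M4 and M5 contain [0:1:0], not [1:0:0]; L2 and L3 do not contain [0:1:0].
   The covectors are normalized by a coordinate that is thus nonzero. *)
pose a := d L2 0 0 / d L2 1 0; pose b := d L2 2 0 / d L2 1 0.
pose a' := d L3 0 0 / d L3 1 0; pose b' := d L3 2 0 / d L3 1 0.
pose m := d M4 2 0 / d M4 0 0; pose n := d M5 2 0 / d M5 0 0.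
have dM1 : proportional (col3 0 0 1) (d M1).
  apply: (@proportional_col3 _ (d M1 2 0));
  by rewrite ?z1 // ?x0 ?y0 // ?mulr0 ?mulr1.
have dM2 : proportional (col3 1 0 0) (d M2).
  apply: (@proportional_col3 _ (d M2 0 0));
  by rewrite ?x1 // ?y0 ?z0 // ?mulr0 ?mulr1.
have dM3 : proportional (col3 1 0 (-1)) (d M3).
  apply: (@proportional_col3 _ (d M3 0 0)); rewrite ?x1 // ?mulr0 ?mulr1 ?y0 //.
  by apply/eqP; rewrite mulrN1 -addr_eq0 addrC -(s0 M3) // (y0 M3) // addr0.
have dM4 : proportional (col3 1 0 m) (d M4).
  apply: (@proportional_col3 _ (d M4 0 0)); rewrite ?x1 // ?mulr0 ?mulr1 ?y0 //.
  by rewrite mulrC divfK // x1.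
have dM5 : proportional (col3 1 0 n) (d M5).
  apply: (@proportional_col3 _ (d M5 0 0)); rewrite ?x1 // ?mulr0 ?mulr1 ?y0 //.
  by rewrite mulrC divfK // x1.
have dL1 : proportional (col3 (-1) 1 0) (d L1).
  apply: (@proportional_col3 _ (d L1 1 0)); rewrite ?y1 // ?mulr0 ?mulr1 ?z0 //.
  by apply/eqP; rewrite mulrN1 -addr_eq0 -(s0 L1) // (z0 L1) // addr0.
have dL2 : proportional (col3 a 1 b) (d L2).
  apply: (@proportional_col3 _ (d L2 1 0));
  by rewrite ?mulr1 // 1?mulrC ?divfK // y1.
have dL3 : proportional (col3 a' 1 b') (d L3).
  apply: (@proportional_col3 _ (d L3 1 0));
  by rewrite ?mulr1 // 1?mulrC ?divfK // y1.
have dL4 : proportional (col3 0 1 (-1)) (d L4).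
  apply: (@proportional_col3 _ (d L4 1 0)); rewrite ?y1 // ?mulr0 ?mulr1 ?x0 //.
  by apply/eqP; rewrite mulrN1 -addr_eq0 addrC -(s0 L4) // (x0 L4) // add0r.
have dL5 : proportional (col3 0 1 0) (d L5).
  apply: (@proportional_col3 _ (d L5 1 0));
  by rewrite ?y1 // ?x0 ?z0 // ?mulr0 ?mulr1.
have e6 := conc 'P_6 _ _ _ _ _ _ _ _ _ _ _ _ dM3 dL2 dL5 isT.
have e4 := conc 'P_4 _ _ _ _ _ _ _ _ _ _ _ _ dM2 dL3 dL4 isT.
have e1 := conc 'P_1 _ _ _ _ _ _ _ _ _ _ _ _ dM1 dL2 dL3 isT.
have e7 := conc 'P_7 _ _ _ _ _ _ _ _ _ _ _ _ dM4 dL1 dL2 isT.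
have e8 := conc 'P_8 _ _ _ _ _ _ _ _ _ _ _ _ dM4 dL3 dL5 isT.
have e10 := conc 'P_10 _ _ _ _ _ _ _ _ _ _ _ _ dM5 dL2 dL4 isT.
have e9 := conc 'P_9 _ _ _ _ _ _ _ _ _ _ _ _ dM5 dL1 dL3 isT.
have eqD (x y z : C) : z = 0 -> x - y = z -> x = y.
  by move=> -> /eqP; rewrite subr_eq0 => /eqP.
(* L2 and L3 become y = - a (x - z) and y = - a x + z. *)
have ba : - a = b by apply: (eqD _ _ _ e6); ring.
have a'a : a = a' by apply: (eqD _ _ _ e1); ring.
have b'N : -1 = b' by apply: (eqD _ _ _ e4); ring.
rewrite -a'a -b'N -ba in e7 e8 e9 e10 dL2 dL3.
(* The condition e8 is 1 + m * a = 0; its sum with e7 is linear in m. *)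
have mE : - a + 1 = m.
  by apply: (eqD _ _ _ (etrans (congr2 +%R e7 e8) (addr0 0))); ring.
(* Adding e9 and e10 eliminates the product n * a. *)
have nE : - (- a + 2) = n.
  by apply: (eqD _ _ _ (etrans (congr2 +%R e9 e10) (addr0 0))); ring.
exists (- a).
  by apply/eqP; rewrite -oppr_eq0 -[X in _ == X]e8 -mE; apply/eqP; ring.
rewrite -mE in dM4; rewrite -nE in dM5.
rewrite -{1}[a]opprK in dL2; rewrite -[a]opprK in dL3.
case=> [[|[|[|[|[|[|[|[|[|[|//]]]]]]]]]] l10];
  rewrite (bool_irrelevance l10 isT) /covectorC (tnth_nth 0).
- exact: dM1.
- exact: dM2.
- exact: dM3.
- exact: dM4.
- exact: dM5.
- exact: dL1.
- exact: dL2.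
- exact: dL3.
- exact: dL4.
exact: dL5.
Qed.

End Classification.

(** * The moduli space *)

Section ModuliSpace.
Variable R : realType.
Local Notation C := R[i].

Lemma arrangement_realizes (g : C) : g ^+ 2 + g - 1 = 0 ->
  ordered_realizations R combinatoricsC (arrangementC g).
Proof.
move=> /coordinatizesC wc; rewrite arrangementCE.
exact: (coordinates_realization (K := combinatoricsC) incC_separated wc).
Qed.

Lemma realization_orbit (A : 'I_10 -> set (P2 R)) :
    ordered_realizations R combinatoricsC A ->
  exists2 g : C, g ^+ 2 + g - 1 = 0 &
    PGL3_orbit (arrangementC g) = PGL3_orbit A.
Proof.
move=> /realization_coordinates[c [w [-> /coordinates_normal_form]]].
move=> [X Xu [g g_root gX]]; exists g => //.
rewrite arrangementCE; apply/esym/PGL3_orbit_line_eq; exists X => // l.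
exact/esym/line_proportional.
Qed.

(** The six lines spanned by the frame have the same equations for [g] and [g'],
    so a matrix mapping one arrangement to the other fixes [1:0:0], [0:1:0],
    [0:0:1], hence is diagonal, and [1:1:1], hence is scalar. It then fixes
    [1:g':0], the point at infinity of L2. *)
Lemma arrangementC_orbit_inj (g g' : C) :
  PGL3_orbit (arrangementC g) = PGL3_orbit (arrangementC g') -> g = g'.
Proof.
rewrite !arrangementCE => /PGL3_orbit_line_eq[X Xu gX].
(* If (x, y, z) is on the line l for g', its image is on the line l for g. *)
have H l x y z a b c a' b' c' :
    covectorC g l = col3 a b c -> covectorC g' l = col3 a' b' c' ->
    x * a' + y * b' + z * c' = 0 ->
  (x * X 0 0 + y * X 1 0 + z * X 2 0) * a
  + (x * X 0 1 + y * X 1 1 + z * X 2 1) * b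
  + (x * X 0 2 + y * X 1 2 + z * X 2 2) * c = 0.
  move=> lE lE' xyz; apply/eqP.
  have /eqP : row3 x y z *m (X *m covectorC g l) = 0.
    apply: line_eq_incident (gX l) _.
    by apply/eqP; rewrite lE' incident_col3 !row3E xyz.
  rewrite mulmxA lE incident_col3.
  by congr (_ * a + _ * b + _ * c == 0); rewrite mxE big_ord3 !row3E.
have [X01 X02] : X 0 1 = 0 /\ X 0 2 = 0.
  split; first by rewrite -[RHS](H L5 1 0 0 0 1 0 0 1 0) //; ring.
  by rewrite -[RHS](H M1 1 0 0 0 0 1 0 0 1) //; ring.
have [X10 X12] : X 1 0 = 0 /\ X 1 2 = 0.
  split; first by rewrite -[RHS](H M2 0 1 0 1 0 0 1 0 0) //; ring.
  by rewrite -[RHS](H M1 0 1 0 0 0 1 0 0 1) //; ring.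
have [X20 X21] : X 2 0 = 0 /\ X 2 1 = 0.
  split; first by rewrite -[RHS](H M2 0 0 1 1 0 0 1 0 0) //; ring.
  by rewrite -[RHS](H L5 0 0 1 0 1 0 0 1 0) //; ring.
have X11 : X 1 1 = X 0 0.
  have := H L1 1 1 1 (-1) 1 0 (-1) 1 0 erefl erefl.
  rewrite X01 X02 X10 X12 X20 X21 => E.
  apply/eqP; rewrite -subr_eq0 -[X in _ == X]E.
    by apply/eqP; ring.
  by ring.
have X22 : X 2 2 = X 1 1.
  have := H L4 1 1 1 0 1 (-1) 0 1 (-1) erefl erefl.
  rewrite X01 X02 X10 X12 X20 X21 => E.
  apply/eqP; rewrite eq_sym -subr_eq0 -[X in _ == X]E.
    by apply/eqP; ring.
  by ring.
have X00 : X 0 0 != 0.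
  apply: contraTneq Xu => X00; rewrite (_ : X = 0) ?unitmxE ?det0 ?unitr0 //.
  by apply/matrixP; apply: ord3P; apply: ord3P; rewrite mxE ?X22 ?X11 ?X00.
have := H L2 1 g' 0 (- g) 1 g (- g') 1 g' erefl erefl.
rewrite X01 X02 X10 X12 X20 X21 X11 => E.
have /eqP : X 0 0 * (g' - g) = 0 by rewrite -[RHS]E; ring.
by rewrite mulf_eq0 (negPf X00) subr_eq0 => /eqP.
Qed.

Lemma golden_roots : exists a : C, a != - 1 - a /\
  [set g : C | g ^+ 2 + g - 1 = 0] = [set a; - 1 - a].
Proof.
pose s : C := sqrtC 5; have s2 : s ^+ 2 = 5 by apply: sqrtCK.
have two0 : (2 : C) != 0 by rewrite pnatr_eq0.
exists ((s - 1) / 2); split.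
  rewrite -subr_eq0 (_ : _ - _ = s); last by field.
  by rewrite -sqrf_eq0 s2 pnatr_eq0.
have fact (g : C) :
    g ^+ 2 + g - 1 = (g - (s - 1) / 2) * (g - (- 1 - (s - 1) / 2)).
  transitivity (g ^+ 2 + g + (1 - s ^+ 2) / 4); last by field.
  by rewrite s2; field.
apply/seteqP; split=> g /=; rewrite fact.
  by move/eqP; rewrite mulf_eq0 !subr_eq0 => /orP[]/eqP; [left|right].
by case=> ->; rewrite subrr ?mul0r ?mulr0.
Qed.

End ModuliSpace.

Theorem proposition3p7 (R : realType) :
  (ordered_moduli_space R combinatoricsC #= `I_2)%card /\
  (forall g : R[i], g ^+ 2 + g - 1 = 0 ->
     ordered_realizations R combinatoricsC (arrangementC g)) /\
  set_bij [set g : R[i] | g ^+ 2 + g - 1 = 0]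
    (ordered_moduli_space R combinatoricsC)
    (fun g => PGL3_orbit (arrangementC g)).
Proof.
have bij : set_bij [set g : R[i] | g ^+ 2 + g - 1 = 0]
    (ordered_moduli_space R combinatoricsC)
    (fun g => PGL3_orbit (arrangementC g)).
  split=> [g g_root|g g' _ _|_ [A AC <-]]; last exact: realization_orbit.
    by exists (arrangementC g) => //; apply: arrangement_realizes.
  exact: arrangementC_orbit_inj.
split; last by split=> // g; apply: arrangement_realizes.
case: bij => funf injf surjf.
have -> : ordered_moduli_space R combinatoricsC =
    (fun g => PGL3_orbit (arrangementC g)) @`
      [set g : R[i] | g ^+ 2 + g - 1 = 0].
  by apply/seteqP; split=> [|_ [g g_root <-]]; [exact: surjf|exact: funf].
rewrite (card_eql (inj_card_eq injf)).
have [a [a_neq ->]] := golden_roots R.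
pose f n : R[i] := if n is 0%N then a else - 1 - a.
have -> : [set a; - 1 - a] = f @` `I_2.
  apply/seteqP; split=> [_ [->|->]|_ [[|[|//]] _ <-]]; [|  |by left|by right].
    by exists 0%N.
  by exists 1%N.
apply: inj_card_eq => m n; rewrite !inE.
case: m n => [|[|//]] [|[|//]] // _ _ /eqP; rewrite /= ?(negPf a_neq) //.
by rewrite eq_sym (negPf a_neq).
Qed.
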